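(* Let $(X,d_X)$ be a finitely ramified fractal with undistorted metric $d_X$, let $(Y,d_Y)$ be a metric space, and let $f\colon X\to Y$ be a homeomorphism. Then $f$ is a quasisymmetry if and only if the pullback metric $f^*(d_Y)$ on $X$ is undistorted, where $f^*(d_Y)(x,y)=d_Y(f(x),f(y))$.
   Context: A finitely ramified cell structure on a compact, connected, metrizable space $X$ consists of a locally finite rooted tree of subsets of $X$, called cells, such that: (1) every cell is compact, connected, and has nonempty interior; (2) the root is the whole space $X$, and each cell is the union of its children; (3) the intersection of any two distinct cells at the same level is a finite set; (4) for every infinite descending path $X=E_0\supseteq E_1\supseteq\cdots$ in the tree, $\bigcap_n E_n$ is a single point. Cells at level $n$ are called $n$-cells (the root being at level $0$). The same subset may occur at several levels; formally a cell is a pair $(E,n)$. A finitely ramified fractal is a metrizable space with a finitely ramified cell structure. Metrics on $X$ are understood to induce the topology of $X$. A metric $d$ on $X$ is undistorted if: (Exponential Decay) there are constants $0<r\le R<1$ and $C\ge1$ such that $\frac{r^{n-m}}{C}\le\frac{\operatorname{diam}(E')}{\operatorname{diam}(E)}\le CR^{n-m}$ for every $m$-cell $E$ and $n$-cell $E'$ with $n\ge m$ and $E\cap E'\neq\emptyset$; and (Cell Separation) there is $\delta>0$ such that $d(E_1,E_2)\ge\delta\operatorname{diam}(E_1)$ for every pair $E_1,E_2$ of disjoint $n$-cells (same $n$), where $d(E_1,E_2)=\inf\{d(x,y):x\in E_1,y\in E_2\}$. A homeomorphism $h\colon (X,d_X)\to (Y,d_Y)$ between metric spaces is a quasisymmetry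 if there is a homeomorphism $\eta\colon[0,\infty)\to[0,\infty)$ with $\frac{d_Y(h(a),h(b))}{d_Y(h(a),h(c))}\le \eta\left(\frac{d_X(a,b)}{d_X(a,c)}\right)$ for every triple $a,b,c$ of distinct points of $X$. *)

(* Defs.v *)
From HB Require Import structures.
From mathcomp Require Export all_boot all_order all_algebra.
From mathcomp Require Export all_classical all_reals all_analysis.
Export numFieldNormedType.Exports.

Set Implicit Arguments.
Unset Strict Implicit.
Unset Printing Implicit Defensive.

Import Order.TTheory GRing.Theory Num.Theory.
Local Open Scope classical_set_scope.
Local Open Scope ring_scope.

(* [cell n] is the set of n-cells, so that a node of the tree is a pair (E, n)
   with [cell n E]; [children n E] is the set of the F such that (F, n.+1) is a
   child of (E, n), and is only meaningful when [cell n E] holds.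
   Applied to the root, the conditions on cells say that X itself is compact,
   connected and nonempty. *)
Record cell_structure (X : topologicalType) := CellStructure {
  cell : nat -> set (set X) ;
  children : nat -> set X -> set (set X) ;
  cell0 : cell 0 = [set [set: X]] ;
  children_cell : forall n E, cell n E -> children n E `<=` cell n.+1 ;
  unique_parent : forall n F, cell n.+1 F ->
    exists! E, cell n E /\ children n E F ;
  finite_children : forall n E, cell n E -> finite_set (children n E) ;
  cell_compact : forall n E, cell n E -> compact E ;
  cell_connected : forall n E, cell n E -> connected E ;
  cell_interior : forall n E, cell n E -> E° !=set0 ;
  cell_children : forall n E, cell n E -> E = \bigcup_(F in children n E) F ;
  finite_cellI : forall n E F, cell n E -> cell n F -> E <> F ->
    finite_set (E `&` F) ;
  branch_point : forall p : nat -> set X,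
    (forall n, cell n (p n)) -> (forall n, children n (p n) (p n.+1)) ->
    exists x, \bigcap_n p n = [set x]
}.

Record is_metric (R : realType) (X : topologicalType) (d : X -> X -> R) :
    Prop := IsMetric {
  dist_ge0 : forall x y, 0 <= d x y ;
  dist_eq0 : forall x y, d x y = 0 <-> x = y ;
  dist_sym : forall x y, d x y = d y x ;
  dist_triangle : forall x y z, d x z <= d x y + d y z ;
  dist_nbhs : forall (x : X) (A : set X),
    nbhs x A <-> exists2 e, 0 < e & [set y | d x y < e] `<=` A
}.

(* [sup] and [inf] return 0 on sets with no real supremum or infimum; this does
   not happen on cells, which are nonempty and bounded for a metric inducing the
   topology. *)
Definition diam (R : realType) (X : Type) (d : X -> X -> R) (E : set X) : R :=
  sup [set z | exists x y, [/\ E x, E y & z = d x y]].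

Definition set_dist (R : realType) (X : Type) (d : X -> X -> R)
    (E F : set X) : R :=
  inf [set z | exists x y, [/\ E x, F y & z = d x y]].

(* As [x / 0 = 0], the lower bound fails when [diam d E = 0], that is, exactly
   when X is a single point, where the ratio has no meaning anyway: in any other
   X, a cell is infinite because it has interior and X has no isolated point. *)
Definition exponential_decay (R : realType) (X : topologicalType)
    (S : cell_structure X) (d : X -> X -> R) : Prop :=
  exists r rho C : R, [/\ 0 < r, r <= rho, rho < 1, 1 <= C &
    forall (m n : nat) (E E' : set X), (m <= n)%N ->
      cell S m E -> cell S n E' -> E `&` E' !=set0 ->
      r ^+ (n - m) / C <= diam d E' / diam d E <= C * rho ^+ (n - m)].

Definition cell_separation (R : realType) (X : topologicalType)
    (S : cell_structure X) (d : X -> X -> R) : Prop :=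
  exists2 delta : R, 0 < delta &
    forall (n : nat) (E1 E2 : set X), cell S n E1 -> cell S n E2 ->
      E1 `&` E2 = set0 -> delta * diam d E1 <= set_dist d E1 E2.

Definition undistorted (R : realType) (X : topologicalType)
    (S : cell_structure X) (d : X -> X -> R) : Prop :=
  [/\ is_metric d, exponential_decay S d & cell_separation S d].

Definition homeomorphism (X Y : topologicalType) (f : X -> Y) : Prop :=
  exists g : Y -> X, [/\ cancel f g, cancel g f, continuous f & continuous g].

Definition homeomorphism_on (X Y : topologicalType) (A : set X) (B : set Y)
    (f : X -> Y) : Prop :=
  exists g : Y -> X,
    [/\ (forall x, A x -> B (f x) /\ g (f x) = x),
        (forall y, B y -> A (g y) /\ f (g y) = y),
        {within A, continuous f} & {within B, continuous g}].

Definition quasisymmetry (R : realType) (X Y : metricType R) (h : X -> Y) :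
    Prop :=
  homeomorphism h /\
  exists2 eta : R -> R,
    homeomorphism_on [set t : R | 0 <= t] [set t : R | 0 <= t] eta &
    forall a b c : X, a <> b -> a <> c -> b <> c ->
      mdist (h a) (h b) / mdist (h a) (h c) <= eta (mdist a b / mdist a c).

Definition pullback_metric (R : realType) (X Y : Type) (f : X -> Y)
    (d : Y -> Y -> R) : X -> X -> R :=
  fun x y => d (f x) (f y).

(* Main.v *)
Require Import Defs.
From mathcomp Require Import lra.

(* If [d] is undistorted, [d x y] is comparable to the diameter of any n-cell
   containing [x], where [n] is a level such that [x] and [y] lie in two meeting
   n-cells but not in two meeting (n+1)-cells. Such levels depend only on the
   cell structure, so for two undistorted metrics the ratios [d a b / d a c] and
   [e a b / e a c] are both controlled by exponentials in the same difference of
   levels, and the identity is a power quasisymmetry.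
   Conversely, for meeting sets [E] and [F], a gauge [eta] bounds the ratio of
   their [e]-diameters by a function of the ratio of their [d]-diameters that
   tends to 0 at 0. Along the cells containing a given point, the [e]-diameter
   is thus halved every [k0] levels, and shrinks by at most a constant factor at
   each level. Cell separation transfers because the gauge bounds [e x z] by a
   multiple of [e x y] for [x, z] in a cell and [y] in a disjoint one. *)

Set Implicit Arguments.
Unset Strict Implicit.
Unset Printing Implicit Defensive.

Import Order.TTheory GRing.Theory Num.Theory.
Local Open Scope classical_set_scope.
Local Open Scope ring_scope.

(** * Homeomorphisms of the half-line *)

Lemma within_nneg_continuous_can (R : realType) (F G : R -> R) :
  (forall x, 0 <= x -> 0 <= F x) ->
  (forall x, 0 <= x -> 0 <= G x /\ F (G x) = x) ->
  (forall x y, 0 <= x -> 0 <= y -> (F x < F y) = (x < y)) ->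
  {within [set t : R | 0 <= t], continuous F}.
Proof.
move=> F0 GK Flt; apply/subspace_continuousP => x /= x0.
apply/cvgrPdist_lt => e e0.
have Fx0 := F0 _ x0.
have [u0 Fu] : 0 <= G (F x + e) /\ F (G (F x + e)) = F x + e.
  by apply: GK; rewrite addr_ge0// ltW.
have xu : x < G (F x + e) by rewrite -Flt// Fu ltrDl.
have upper : \forall y \near within [set t : R | 0 <= t] (nbhs x),
    F y < F x + e.
  apply: filterS (lt_nbhsl xu) => y yu /= y0.
  by rewrite -Fu Flt.
have lower : \forall y \near within [set t : R | 0 <= t] (nbhs x),
    F x - e < F y.
  (* Here [F x - e] is negative, so [G] gives no preimage of it; the bound comes from [F] being
     nonnegative. *)
  have [Fxe|eFx] := ltP (F x) e.
    apply: filterS (@withinT _ (nbhs x) [set t : R | 0 <= t] _) => y /F0.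
    by lra.
  have [l0 Fl] : 0 <= G (F x - e) /\ F (G (F x - e)) = F x - e.
    by apply: GK; rewrite subr_ge0.
  have lx : G (F x - e) < x by rewrite -Flt// Fl; lra.
  apply: filterS (lt_nbhsr lx) => y yl /= y0.
  by rewrite -Fl Flt.
by move: lower upper; apply: filterS2 => y lFy Fyu; rewrite ltr_distlC lFy.
Qed.

(** Order alone gives continuity: being injective and monotone, [F] and [G] are strictly increasing,
    and each is the inverse that the previous lemma needs for the other. *)
Lemma homeomorphism_nneg_can (R : realType) (F G : R -> R) :
  (forall x, 0 <= x -> 0 <= F x /\ G (F x) = x) ->
  (forall x, 0 <= x -> 0 <= G x /\ F (G x) = x) ->
  (forall x y, 0 <= x -> 0 <= y -> x <= y -> F x <= F y) ->
  homeomorphism_on [set t : R | 0 <= t] [set t : R | 0 <= t] F.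
Proof.
move=> FK GK Fle.
have Flt x y : 0 <= x -> 0 <= y -> (F x < F y) = (x < y).
  move=> x0 y0; apply/idP/idP => [Fxy|xy].
    by rewrite ltNge; apply/negP => /(Fle _ _ y0 x0); rewrite leNgt Fxy.
  rewrite lt_neqAle Fle// 1?ltW// andbT; apply/eqP => Fxy.
  by move: xy; rewrite -(FK x x0).2 Fxy (FK y y0).2 ltxx.
have Glt x y : 0 <= x -> 0 <= y -> (G x < G y) = (x < y).
  move=> x0 y0; have [Gx0 FGx] := GK _ x0; have [Gy0 FGy] := GK _ y0.
  by rewrite -(Flt (G x))// FGx FGy.
exists G; split=> //.
  by apply: within_nneg_continuous_can GK Flt => x /FK[].
by apply: within_nneg_continuous_can FK Glt => x /GK[].
Qed.

(** A continuous injection of an interval is strictly monotone. A decreasing [eta] would be bounded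
    by [eta 0], yet it takes the value [eta 0 + 1]. *)
Lemma homeomorphism_nneg_le (R : realType) (eta : R -> R) :
  homeomorphism_on [set t : R | 0 <= t] [set t : R | 0 <= t] eta ->
  [/\ eta 0 = 0, forall s t, 0 <= s -> s <= t -> eta s <= eta t &
    forall s, 0 < s -> exists2 t, 0 < t & eta t = s].
Proof.
move=> [g [etaK gK ceta _]].
have mono : unstable.strict_monotonic `[0, +oo[ eta.
  apply: itv_continuous_inj_mono.
    suff -> : [set` `[(0:R), +oo[] = [set t : R | 0 <= t] by [].
    by apply/seteqP; split => x /=; rewrite in_itv/= andbT.
  move=> x y; rewrite !in_itv/= !andbT => x0 y0 xy.
  by rewrite -(etaK _ x0).2 xy (etaK _ y0).2.
have [g0 eg0] := gK _ (lexx 0); rewrite /= in g0.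
case: mono => [inc|dec]; last first.
  have e0 := (etaK _ (lexx 0)).1; rewrite /= in e0.
  have [/= g1 eg1] : 0 <= g (eta 0 + 1) /\ eta (g (eta 0 + 1)) = eta 0 + 1.
    by apply: gK => /=; lra.
  have : eta 0 + 1 <= eta 0.
    rewrite -{1}eg1 le_eqVlt; move: g1; rewrite le_eqVlt => /orP[/eqP<-|g1].
      by rewrite eqxx.
    by rewrite dec ?orbT// in_itv/= andbT// ltW.
  by lra.
have le s t : 0 <= s -> s <= t -> eta s <= eta t.
  move=> s0; rewrite le_eqVlt => /orP[/eqP->//|st].
  apply: ltW; apply: inc => //.
    by rewrite in_itv/= s0.
  by rewrite in_itv/= andbT (le_trans s0)// ltW.
have eta0 : eta 0 = 0.
  by apply/eqP; rewrite eq_le (etaK _ (lexx 0)).1 andbT -{2}eg0 le.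
split => // s s0; have [/= gs0 egs] := gK _ (ltW s0); exists (g s) => //.
rewrite lt_neqAle gs0 andbT; apply/eqP => gs.
by move: s0; rewrite -egs -gs eta0 ltxx.
Qed.

(** * Real powers and gauges that are a maximum of two powers *)

Lemma exists_expr_lt (R : realType) (x e : R) :
  0 < x < 1 -> 0 < e -> exists k, x ^+ k < e.
Proof.
move=> /andP[x0 x1] e0.
have /cvgrPdist_lt/(_ e e0)[N _ /(_ N (leqnn N))] :
    (GRing.exp x : R ^nat) @ \oo --> 0.
  by apply: cvg_expr; rewrite ger0_norm// ltW.
by rewrite /= sub0r normrN ger0_norm ?exprn_ge0// 1?ltW//; exists N.
Qed.

Lemma exists_powR_eq (R : realType) (r s : R) :
  0 < r < 1 -> 0 < s < 1 -> exists2 a, 0 < a & r `^ a = s.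
Proof.
move=> r01 s01; have lr := ln_lt0 r01; have ls := ln_lt0 s01.
case/andP: r01 => r0 _; case/andP: s01 => s0 _.
exists (ln s / ln r); first by rewrite ltr_ndivlMr// mul0r.
by rewrite /powR gt_eqF// divfK ?lt_eqF// lnK.
Qed.

Lemma powRVr (R : realType) (x a : R) : 0 <= x -> x^-1 `^ a = (x `^ a)^-1.
Proof. by move=> x0; rewrite -powR_inv1// powRAC powR_inv1// powR_ge0. Qed.

Lemma powRK (R : realType) (x a : R) : 0 <= x -> 0 < a -> x `^ a `^ a^-1 = x.
Proof. by move=> x0 a0; rewrite -powRrM mulfV ?gt_eqF// powRr1. Qed.

Lemma powRVK (R : realType) (x a : R) : 0 <= x -> 0 < a -> x `^ a^-1 `^ a = x.
Proof. by move=> x0 a0; rewrite -powRrM mulVf ?gt_eqF// powRr1. Qed.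

(** The inverse of a maximum of two increasing bijections is the minimum of their inverses. *)
Lemma powR_max_min (R : realType) (x a b : R) : 0 <= x -> 0 < a -> 0 < b ->
  let y := Num.max (x `^ a) (x `^ b) in Num.min (y `^ a^-1) (y `^ b^-1) = x.
Proof.
move=> x0 a0 b0 /=; case: (leP (x `^ a) (x `^ b)) => [ab|/ltW ba].
  rewrite (@powRK _ x b)//; apply/min_idPr.
  by rewrite -{1}(powRK x0 a0) ge0_ler_powR ?nnegrE ?powR_ge0 ?invr_ge0// ltW.
rewrite (@powRK _ x a)//; apply/min_idPl.
by rewrite -{1}(powRK x0 b0) ge0_ler_powR ?nnegrE ?powR_ge0 ?invr_ge0// ltW.
Qed.

Lemma powR_min_max (R : realType) (x a b : R) : 0 <= x -> 0 < a -> 0 < b ->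
  let y := Num.min (x `^ a^-1) (x `^ b^-1) in Num.max (y `^ a) (y `^ b) = x.
Proof.
move=> x0 a0 b0 /=; case: (leP (x `^ a^-1) (x `^ b^-1)) => [ab|/ltW ba].
  rewrite (@powRVK _ x a)//; apply/max_idPl.
  by rewrite -{2}(powRVK x0 b0) ge0_ler_powR ?nnegrE ?powR_ge0// ltW.
rewrite (@powRVK _ x b)//; apply/max_idPr.
by rewrite -{2}(powRVK x0 a0) ge0_ler_powR ?nnegrE ?powR_ge0// ltW.
Qed.

Lemma homeomorphism_max_powR (R : realType) (K L a b : R) :
  0 < K -> 0 < L -> 0 < a -> 0 < b ->
  homeomorphism_on [set t : R | 0 <= t] [set t : R | 0 <= t]
    (fun t => K * Num.max ((L * t) `^ a) ((L * t) `^ b)).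
Proof.
move=> K0 L0 a0 b0.
apply: (@homeomorphism_nneg_can _ _
  (fun s => Num.min ((s / K) `^ a^-1) ((s / K) `^ b^-1) / L)) => [x x0|x x0|].
- rewrite mulr_ge0 ?le_max ?powR_ge0 ?(ltW K0)//; split=> //.
  rewrite [K * _]mulrC mulfK ?gt_eqF// powR_max_min ?(mulr_ge0 (ltW L0))//.
  by rewrite mulrC mulKf// gt_eqF.
- rewrite divr_ge0 ?le_min ?powR_ge0 ?(ltW L0)//; split=> //.
  rewrite [L * _]mulrC divfK ?gt_eqF// powR_min_max ?(divr_ge0 _ (ltW K0))//.
  by rewrite mulrC divfK// gt_eqF.
- move=> x y x0 y0 xy; have Lx : L * x <= L * y by rewrite ler_pM2l.
  rewrite ler_pM2l//; have Lx0 := mulr_ge0 (ltW L0) x0.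
  have Ly0 := mulr_ge0 (ltW L0) y0.
  rewrite ge_max !le_max; apply/andP; split; apply/orP; [left|right];
    by rewrite ge0_ler_powR ?nnegrE// ltW.
Qed.

(** * Diameters and set distances on a compact space *)

Lemma dist_gt0 (R : realType) (X : topologicalType) (d : X -> X -> R) x y :
  is_metric d -> x <> y -> 0 < d x y.
Proof.
move=> dm xy; rewrite lt_neqAle (dist_ge0 dm) andbT; apply/eqP => /esym.
by move/(dist_eq0 dm).
Qed.

(** Ensures that the [sup] in [diam] is a true supremum on nonempty sets: the distance to a base
    point is continuous, hence bounded. *)
Lemma metric_bounded (R : realType) (X : topologicalType) (d : X -> X -> R) :
  compact [set: X] -> is_metric d -> exists M, forall x y, d x y <= M.
Proof.
move=> cX [d0 _ dC dT dnbhs].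
have [[x0 _]|X0] := pselect ([set: X] !=set0); last first.
  by exists 0 => x; case: X0; exists x.
have cont : continuous (d x0).
  move=> x; apply/cvgrPdist_lt => e e0.
  apply/dnbhs; exists e => // y /= dxy.
  have := dT x0 x y; have := dT x0 y x; rewrite (dC y x) => ? ?.
  by rewrite ltr_distlC; apply/andP; split; lra.
have [M [_ /(_ (M + 1))]] := compact_bounded
  (continuous_compact (continuous_subspaceT cont) cX).
rewrite ltrDl ltr01 => /(_ isT) dM.
exists ((M + 1) + (M + 1)) => x y; apply: (le_trans (dT x x0 y)).
by rewrite dC; apply: lerD; apply: le_trans (ler_norm _) (dM _ _) => //=;
  [exists x | exists y].
Qed.

Lemma compact_cell_structure (X : topologicalType) (S : cell_structure X) :
  compact [set: X].
Proof. by apply: (@cell_compact X S 0); rewrite cell0. Qed.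

Lemma le_diam (R : realType) (X : topologicalType) (d : X -> X -> R)
    (E : set X) x y :
  compact [set: X] -> is_metric d -> E x -> E y -> d x y <= diam d E.
Proof.
move=> cX dm Ex Ey; apply: ub_le_sup; last by exists x, y.
have [M dM] := metric_bounded cX dm.
by exists M => _ [u [v [_ _ ->]]].
Qed.

Lemma diam_le (R : realType) (X : Type) (d : X -> X -> R) (E : set X) M :
  E !=set0 -> (forall x y, E x -> E y -> d x y <= M) -> diam d E <= M.
Proof.
move=> [x Ex] dM; apply: ge_sup; first by exists (d x x), x, x.
by move=> _ [u [v [Eu Ev ->]]]; exact: dM.
Qed.

Lemma diam_le_radius (R : realType) (X : topologicalType) (d : X -> X -> R)
    (E : set X) p M :
  is_metric d -> E p -> (forall x, E x -> d p x <= M) -> diam d E <= 2 * M.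
Proof.
move=> dm Ep dM; apply: diam_le; first by exists p.
move=> x y Ex Ey; have := dist_triangle dm x p y; rewrite (dist_sym dm x p).
by have := dM x Ex; have := dM y Ey; lra.
Qed.

(** The supremum need not be attained, but if all of [E] were within [diam d E / 3] of [p], the
    diameter would be at most two thirds of itself. *)
Lemma diam_witness (R : realType) (X : topologicalType) (d : X -> X -> R)
    (E : set X) p :
  is_metric d -> E p -> 0 < diam d E ->
  exists2 y, E y & diam d E < 3 * d p y.
Proof.
move=> dm Ep E0; apply: contrapT => noy.
suff : diam d E <= 2 * (diam d E / 3) by lra.
apply: (diam_le_radius dm Ep) => y Ey; rewrite leNgt; apply/negP => ylt.
by apply: noy; exists y => //; lra.
Qed.

Lemma set_dist_le (R : realType) (X : topologicalType) (d : X -> X -> R)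
    (E F : set X) x y :
  is_metric d -> E x -> F y -> set_dist d E F <= d x y.
Proof.
move=> dm Ex Fy; apply: ge_inf; last by exists x, y.
by exists 0 => _ [u [v [_ _ ->]]]; exact: dist_ge0.
Qed.

Lemma le_set_dist (R : realType) (X : Type) (d : X -> X -> R)
    (E F : set X) M :
  E !=set0 -> F !=set0 -> (forall x y, E x -> F y -> M <= d x y) ->
  M <= set_dist d E F.
Proof.
move=> [x Ex] [y Fy] dM; apply: lb_le_inf; first by exists (d x y), x, y.
by move=> _ [u [v [Eu Fv ->]]]; exact: dM.
Qed.

(** * Cells and exponential decay *)

Lemma cell_cover (X : topologicalType) (S : cell_structure X) n x :
  exists2 E, cell S n E & E x.
Proof.
elim: n => [|n [E cE Ex]]; first by exists setT => //; rewrite cell0.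
by move: Ex; rewrite (cell_children cE) => -[F ch Fx]; exists F => //;
  exact: children_cell ch.
Qed.

Lemma cell_nonempty (X : topologicalType) (S : cell_structure X) n E :
  cell S n E -> E !=set0.
Proof. by move=> /cell_interior[x /interior_subset]; exists x. Qed.

(** Decay of [E] against itself gives [1 / C <= diam d E / diam d E], whose right side would be 0 if
    the diameter vanished. *)
Lemma exponential_decay_diam_gt0 (R : realType) (X : topologicalType)
    (S : cell_structure X) (d : X -> X -> R) n E :
  is_metric d -> exponential_decay S d -> cell S n E -> 0 < diam d E.
Proof.
move=> dm [r [rho [C [r0 _ _ C1 decay]]]] cE.
have [x Ex] := cell_nonempty cE.
have /andP[+ _] := decay _ _ _ _ (leqnn n) cE cE (ex_intro _ x (conj Ex Ex)).
rewrite subnn expr0 => le.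
have E0 : 0 <= diam d E.
  rewrite -(iffRL (dist_eq0 dm x x) erefl).
  by apply: le_diam => //; exact: compact_cell_structure S.
rewrite lt_neqAle E0 andbT; apply/eqP => E0'.
move: le; rewrite -E0' mul0r leNgt divr_gt0//.
by rewrite (lt_le_trans _ C1).
Qed.

Lemma exponential_decayP (R : realType) (X : topologicalType)
    (S : cell_structure X) (d : X -> X -> R) :
  is_metric d -> exponential_decay S d ->
  exists r rho C : R, [/\ 0 < r < 1, 0 < rho < 1, 1 <= C &
    forall m k E E' p, cell S m E -> cell S (m + k) E' -> E p -> E' p ->
      r ^+ k * diam d E <= C * diam d E' /\
      diam d E' <= C * rho ^+ k * diam d E].
Proof.
move=> dm dd; have [r [rho [C [r0 rrho rho1 C1 decay]]]] := dd.
exists r, rho, C; split=> //.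
- by rewrite r0 (le_lt_trans rrho).
- by rewrite rho1 (lt_le_trans r0).
move=> m k E E' p cE cE' Ep E'p; have C0 : 0 < C by exact: lt_le_trans C1.
have E0 := exponential_decay_diam_gt0 dm dd cE.
have := decay _ _ _ _ (leq_addr k m) cE cE' (ex_intro _ p (conj Ep E'p)).
rewrite addKn => /andP[lo up]; split; last by rewrite -ler_pdivrMr.
by move: lo; rewrite ler_pdivlMr// mulrAC ler_pdivrMr//
  [leRHS]mulrC.
Qed.

(** * Separation levels and power quasisymmetry *)

Definition joined (X : topologicalType) (S : cell_structure X) (n : nat)
    (x y : X) : Prop :=
  exists E F, [/\ cell S n E, cell S n F, E x, F y & E `&` F !=set0].

Definition separation_level (X : topologicalType) (S : cell_structure X)
    (n : nat) (x y : X) : Prop := joined S n x y /\ ~ joined S n.+1 x y.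

(** Above, a path through two meeting n-cells joins [x] to [y]. Below, the (n+1)-cells around [x]
    and [y] are disjoint, so cell separation applies to them, and one level costs at most a factor
    [C / r] in diameter. *)
Lemma separation_level_dist (R : realType) (X : topologicalType)
    (S : cell_structure X) (d : X -> X -> R) :
  undistorted S d -> exists2 A : R, 0 < A &
    forall n x y E, separation_level S n x y -> cell S n E -> E x ->
      d x y <= A * diam d E /\ diam d E <= A * d x y.
Proof.
move=> [dm dd [delta delta0 sep]]; have cX := compact_cell_structure S.
have [r [rho [C [/andP[r0 r1] rho01 C1 decay]]]] := exponential_decayP dm dd.
have C0 : 0 < C by exact: lt_le_trans C1.
(* [C] bounds the cell of [x] against [E], [C * C] the cell of [y] through it; [C / (r * delta)]
   serves the lower bound. *)
have A1 : 0 < C + C * C by rewrite addr_gt0 ?mulr_gt0.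
have A2 : 0 < C / (r * delta) by rewrite divr_gt0 ?mulr_gt0.
exists ((C + C * C) + C / (r * delta)); first by rewrite addr_gt0.
move=> n x y E [[F [G [cF cG Fx Gy [p [Fp Gp]]]]] nj] cE Ex.
have E0 := exponential_decay_diam_gt0 dm dd cE.
have dxy0 := dist_ge0 dm x y.
have step H K z : cell S n H -> cell S n K -> H z -> K z ->
    diam d K <= C * diam d H.
  move=> cH cK Hz Kz; rewrite -(addn0 n) in cK.
  by have [_] := decay _ _ _ _ _ cH cK Hz Kz; rewrite expr0 mulr1.
split.
  apply: (@le_trans _ _ ((C + C * C) * diam d E)); last first.
    by rewrite ler_pM2r// lerDl ltW.
  apply: (le_trans (dist_triangle dm x p y)); rewrite mulrDl; apply: lerD.
    by apply: le_trans (le_diam cX dm Fx Fp) _; exact: step cE cF Ex Fx.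
  apply: le_trans (le_diam cX dm Gp Gy) _.
  apply: le_trans (step _ _ _ cF cG Fp Gp) _.
  by rewrite -mulrA ler_pM2l//; exact: step cE cF Ex Fx.
apply: (@le_trans _ _ (C / (r * delta) * d x y)); last first.
  by apply: ler_wpM2r => //; rewrite lerDr ltW.
have [F' cF' F'x] := cell_cover S n.+1 x.
have [G' cG' G'y] := cell_cover S n.+1 y.
have disj : F' `&` G' = set0.
  apply/seteqP; split => // z FGz; apply: nj; exists F', G'; split=> //.
  by exists z.
have sepFG := le_trans (sep _ _ _ cF' cG' disj) (set_dist_le dm F'x G'y).
rewrite -addn1 in cF'; have [+ _] := decay _ _ _ _ _ cE cF' Ex F'x.
rewrite expr1 => rE.
rewrite mulrAC ler_pdivlMr ?mulr_gt0//.
apply: (@le_trans _ _ (delta * (C * diam d F'))).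
  by rewrite mulrC -mulrA mulrCA ler_pM2l.
by rewrite mulrCA ler_pM2l.
Qed.

(** All points are joined at level 0, while points joined at level [k] are within
    [2 * C * rho ^+ k * diam d setT], which tends to 0; hence the relation fails for the first time
    somewhere. *)
Lemma separation_level_exists (R : realType) (X : topologicalType)
    (S : cell_structure X) (d : X -> X -> R) x y :
  is_metric d -> exponential_decay S d -> x <> y ->
  exists n, separation_level S n x y.
Proof.
move=> dm dd xy; have cX := compact_cell_structure S.
have [r [rho [C [_ rho01 C1 decay]]]] := exponential_decayP dm dd.
have C0 : 0 < C by exact: lt_le_trans C1.
have cT : cell S 0 setT by rewrite cell0.
have T0 := exponential_decay_diam_gt0 dm dd cT.
have dxy := dist_gt0 dm xy.
have [k rhok] : exists k, rho ^+ k < d x y / (2 * C * diam d setT).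
  by apply: exists_expr_lt => //; rewrite divr_gt0 ?mulr_gt0.
have nj : ~ joined S k x y.
  move=> [F [G [cF cG Fx Gy [p [Fp Gp]]]]].
  have small H z : cell S k H -> H z -> diam d H <= C * rho ^+ k * diam d setT.
    by move=> cH Hz; have [] := decay 0 k _ _ _ cT cH (I : setT z) Hz.
  move: rhok; rewrite ltr_pdivlMr ?mulr_gt0// => rhok.
  have := dist_triangle dm x p y.
  have := le_trans (le_diam cX dm Fx Fp) (small _ _ cF Fx).
  have := le_trans (le_diam cX dm Gp Gy) (small _ _ cG Gy).
  by lra.
have j0 : joined S 0 x y by exists setT, setT; split=> //; exists x.
elim: k nj {rhok} => // k IH nj.
by have [jk|/IH] := pselect (joined S k x y); first by exists k.
Qed.

Lemma separation_level_ratio (R : realType) (X : topologicalType)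
    (S : cell_structure X) (d : X -> X -> R) :
  undistorted S d -> exists r rho K : R, [/\ 0 < r < 1, 0 < rho < 1, 0 < K &
    forall m k a b c,
      separation_level S m a c -> separation_level S (m + k) a b ->
      r ^+ k * d a c <= K * d a b /\ d a b <= K * rho ^+ k * d a c].
Proof.
move=> ud; have [dm dd _] := ud.
have [A A0 levelA] := separation_level_dist ud.
have [r [rho [C [r01 rho01 C1 decay]]]] := exponential_decayP dm dd.
have C0 : 0 < C by exact: lt_le_trans C1.
exists r, rho, (A * A * C); split=> //; first by rewrite !mulr_gt0.
move=> m k a b c lc lb.
have [E cE Ea] := cell_cover S m a.
have [F cF Fa] := cell_cover S (m + k) a.
have [lo up] := decay _ _ _ _ _ cE cF Ea Fa.
have [acE Eac] := levelA _ _ _ _ lc cE Ea.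
have [abF Fab] := levelA _ _ _ _ lb cF Fa.
have rk : 0 <= r ^+ k by case/andP: r01 => /ltW ? _; rewrite exprn_ge0.
have rhok : 0 <= rho ^+ k by case/andP: rho01 => /ltW ? _; rewrite exprn_ge0.
split.
  have := ler_wpM2l rk acE; have := ler_wpM2l (ltW A0) lo.
  have := ler_wpM2l (mulr_ge0 (ltW A0) (ltW C0)) Fab.
  by lra.
have := ler_wpM2l (ltW A0) up.
have := ler_wpM2l (mulr_ge0 (ltW A0) (mulr_ge0 (ltW C0) rhok)) Eac.
by lra.
Qed.

(** The case split is on which of [a, b] and [a, c] separates first. A level gap [k] bounds the
    [d]-ratio below by an exponential in [k] and the [e]-ratio above by another; a power converts
    one into the other. *)
Lemma undistorted_power_quasisymmetric (R : realType) (X : topologicalType)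
    (S : cell_structure X) (d e : X -> X -> R) :
  undistorted S d -> undistorted S e ->
  exists K L alpha beta : R, [/\ 0 < K, 0 < L, 0 < alpha, 0 < beta &
    forall a b c, a <> b -> a <> c ->
      e a b / e a c <= K * Num.max ((L * (d a b / d a c)) `^ alpha)
                                   ((L * (d a b / d a c)) `^ beta)].
Proof.
move=> ud ue; have [dm dd _] := ud; have [em _ _] := ue.
have [r [rho [L [r01 rho01 L0 ratiod]]]] := separation_level_ratio ud.
have [r' [rho' [K [r'01 rho'01 K0 ratioe]]]] := separation_level_ratio ue.
(* [al] turns the slowest contraction seen by [d] into the upper rate of [e]; [be] turns the upper
   rate of [d] into the lower rate of [e]. *)
have [al al0 rho'E] := exists_powR_eq r01 rho'01.
have [be be0 r'E] := exists_powR_eq rho01 r'01.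
exists K, L, al, be; split=> // a b c ab ac.
have dab := dist_gt0 dm ab; have dac := dist_gt0 dm ac.
have eac := dist_gt0 em ac.
have [N lN] := separation_level_exists dm dd ab.
have [M lM] := separation_level_exists dm dd ac.
have powk (x y : R) k : 0 < x < 1 -> (x ^+ k) `^ y = (x `^ y) ^+ k.
  move=> /andP[/ltW x0 _].
  by rewrite -(powR_mulrn k x0) -(powR_mulrn k (powR_ge0 x y)) powRAC.
have exp0 (x : R) k : 0 < x < 1 -> 0 < x ^+ k.
  by move=> /andP[x0 _]; rewrite exprn_gt0.
have t0 : 0 <= L * (d a b / d a c) by rewrite mulr_ge0 ?divr_ge0 ?ltW.
have [MN|/ltnW NM] := leqP M N.
  rewrite -(subnKC MN) in lN; set k := (N - M)%N in lN.
  have [dlo _] := ratiod _ _ _ _ _ lM lN.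
  have [_ eup] := ratioe _ _ _ _ _ lM lN.
  apply: (@le_trans _ _ (K * (r ^+ k) `^ al)).
    by rewrite powk// rho'E ler_pdivrMr.
  rewrite ler_pM2l// le_max; apply/orP; left.
  rewrite ge0_ler_powR ?nnegrE ?(ltW al0) ?(ltW (exp0 _ _ _))//.
  by rewrite mulrA ler_pdivlMr.
rewrite -(subnKC NM) in lM; set k := (M - N)%N in lM.
have [_ dup] := ratiod _ _ _ _ _ lN lM; have [elo _] := ratioe _ _ _ _ _ lN lM.
apply: (@le_trans _ _ (K * (rho ^+ k)^-1 `^ be)).
  rewrite powRVr ?(ltW (exp0 _ _ _))// powk// r'E.
  by rewrite ler_pdivrMr// mulrAC ler_pdivlMr ?exp0// mulrC.
rewrite ler_pM2l// le_max; apply/orP; right.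
rewrite ge0_ler_powR ?nnegrE ?(ltW be0) ?invr_ge0 ?(ltW (exp0 _ _ _))//.
rewrite -div1r ler_pdivrMr ?exp0// mulrA mulrAC ler_pdivlMr// mul1r.
by rewrite mulrAC.
Qed.

(** * Transfer of undistortedness along a gauge *)

Lemma is_metric_pullback (R : realType) (X : topologicalType) (Y : metricType R)
    (f : X -> Y) :
  homeomorphism f -> is_metric (pullback_metric f (@mdist R Y)).
Proof.
move=> [g [fK gK cf cg]]; split; rewrite /pullback_metric.
- by move=> x y; exact: mdist_ge0.
- move=> x y; split=> [/mdist_positivity/(can_inj fK)//|->].
  exact: mdistxx.
- by move=> x y; exact: metric_sym.
- by move=> x y z; exact: metric_triangle.
move=> x A; split.
  (* Continuity of the inverse makes the preimage of [A] under it a neighborhood of [f x], which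
     contains a ball. *)
  rewrite -{1}(fK x) => /cg.
  rewrite -metricType_numDomainType.filter_from_mdist_nbhs => -[e e0 eA].
  by exists e => // y /= /eA; rewrite /= fK.
move=> [e e0 eA]; apply: filterS eA _.
apply: (cf x (fun z => mdist (f x) z < e)).
by rewrite -metricType_numDomainType.filter_from_mdist_nbhs; exists e.
Qed.

(** Positive diameter amounts to having two distinct points, whatever the metric; on the empty set
    [sup] is 0. *)
Lemma diam_gt0_transfer (R : realType) (X : topologicalType)
    (d e : X -> X -> R) (E : set X) :
  compact [set: X] -> is_metric d -> is_metric e ->
  0 < diam d E -> 0 < diam e E.
Proof.
move=> cX dm em E0.
have [[p Ep]|noE] := pselect (E !=set0); last first.
  have E_0 : E = set0 by apply/seteqP; split=> // z Ez; case: noE; exists z.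
  suff : diam d E = 0 by move=> /eqP; rewrite gt_eqF.
  rewrite /diam E_0; suff -> : [set z | exists x y : X,
    [/\ set0 x, set0 y & z = d x y]] = set0 by rewrite sup0.
  by apply/seteqP; split=> // z [x [y []]].
have [y Ey dpy] := diam_witness dm Ep E0.
apply: lt_le_trans (le_diam cX em Ep Ey); apply: dist_gt0 => // py.
by move: dpy; rewrite py (iffRL (dist_eq0 dm y y) erefl) mulr0 ltNge ltW.
Qed.

(** The quasisymmetry inequality for the identity from [d] to [e]; with [e] a pullback, the theorem
    compares two metrics on one space. *)
Definition gauge_dominated (R : realType) (X : Type) (eta : R -> R)
    (d e : X -> X -> R) : Prop :=
  forall a b c : X, a <> b -> a <> c -> b <> c ->
    e a b / e a c <= eta (d a b / d a c).

Lemma gauge_dominated_le (R : realType) (X : topologicalType) (eta : R -> R)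
    (d e : X -> X -> R) t a b c :
  is_metric d -> is_metric e ->
  (forall s t, 0 <= s -> s <= t -> eta s <= eta t) -> 0 <= eta 0 ->
  gauge_dominated eta d e -> a <> c -> b <> c ->
  d a b <= t * d a c -> e a b <= eta t * e a c.
Proof.
move=> dm em mono eta0 dom ac bc dt.
have dac := dist_gt0 dm ac; have eac := dist_gt0 em ac.
have rt : d a b / d a c <= t by rewrite ler_pdivrMr.
have r0 : 0 <= d a b / d a c by rewrite divr_ge0 ?(dist_ge0 dm).
have [ab|ab] := pselect (a = b).
  rewrite -ab (iffRL (dist_eq0 em a a) erefl) mulr_ge0 ?(ltW eac)//.
  by apply: le_trans eta0 (mono _ _ (lexx 0) (le_trans r0 rt)).
rewrite -ler_pdivrMr//; apply: le_trans (dom a b c ab ac bc) _.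
exact: mono.
Qed.

(* If [3 M < 1], a point of [F] far from [p] lies outside [E], which removes
   the degenerate case [b = c] of the quasisymmetry inequality. *)
Lemma gauge_dominated_diam (R : realType) (X : topologicalType) (eta : R -> R)
    (d e : X -> X -> R) M (E F : set X) p :
  compact [set: X] -> is_metric d -> is_metric e ->
  (forall s t, 0 <= s -> s <= t -> eta s <= eta t) -> 0 <= eta 0 ->
  gauge_dominated eta d e -> E p -> F p -> 0 < diam d F ->
  0 <= M -> diam d E <= M * diam d F ->
  diam e E <= 2 * (1 + eta (3 * M)) * diam e F /\
  (3 * M < 1 -> diam e E <= 2 * eta (3 * M) * diam e F).
Proof.
move=> cX dm em mono eta0 dom Ep Fp F0 M0 EF.
have [y Fy dpy] := diam_witness dm Fp F0.
have py : p <> y.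
  by move=> py; move: dpy; rewrite py (iffRL (dist_eq0 dm y y) erefl); lra.
have dEy z : E z -> d p z <= 3 * M * d p y.
  move=> Ez; apply: le_trans (le_diam cX dm Ep Ez) _; apply: le_trans EF _.
  by rewrite -mulrA mulrCA ler_wpM2l// ltW.
have etaM : 0 <= eta (3 * M).
  by apply: le_trans eta0 (mono _ _ (lexx 0) _); rewrite mulr_ge0.
have epy := le_diam cX em Fp Fy.
have eF : 0 <= diam e F by apply: le_trans epy; exact: dist_ge0.
have main z : E z -> z <> y -> e p z <= eta (3 * M) * diam e F.
  move=> Ez zy; apply: (@le_trans _ _ (eta (3 * M) * e p y)).
    exact: gauge_dominated_le (dEy z Ez).
  by rewrite ler_wpM2l.
split=> [|M1]; rewrite -mulrA; apply: (diam_le_radius em Ep) => z Ez.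
  (* At [z = y] the gauge says nothing, and [e p y <= diam e F] accounts for the summand 1. *)
  have [->|zy] := pselect (z = y).
    by apply: le_trans epy _; rewrite mulrDl mul1r lerDl mulr_ge0.
  by apply: le_trans (main z Ez zy) _; rewrite ler_wpM2r// lerDr.
apply: main => // zy; have := dEy z Ez; rewrite zy leNgt => /negP; apply.
by rewrite gtr_pMl//; exact: dist_gt0.
Qed.

Lemma gauge_dominated_separation (R : realType) (X : topologicalType)
    (S : cell_structure X) (eta : R -> R) (d e : X -> X -> R) :
  is_metric d -> is_metric e ->
  (forall s t, 0 <= s -> s <= t -> eta s <= eta t) -> eta 0 = 0 ->
  gauge_dominated eta d e ->
  cell_separation S d -> cell_separation S e.
Proof.
move=> dm em mono eta0 dom [delta delta0 sep].
have cX := compact_cell_structure S.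
have eta_ge0 : 0 <= eta delta^-1.
  by rewrite -{1}eta0 mono// invr_ge0 ltW.
(* The hypotheses only make [eta] nonnegative; the added 1 keeps the constant invertible. *)
have c0 : 0 < 2 * (1 + eta delta^-1) by rewrite mulr_gt0// ltr_pwDl.
exists (2 * (1 + eta delta^-1))^-1; first by rewrite invr_gt0.
move=> n E F cE cF EF.
apply: le_set_dist (cell_nonempty cE) (cell_nonempty cF) _.
move=> x y Ex Fy; rewrite mulrC ler_pdivrMr// mulrC -mulrA.
have ney z : E z -> z <> y.
  move=> Ez zy; suff : (E `&` F) y by rewrite EF.
  by split=> //; rewrite -zy.
have dxy := le_trans (sep _ _ _ cE cF EF) (set_dist_le dm Ex Fy).
apply: (diam_le_radius em Ex) => z Ez.
apply: (@le_trans _ _ (eta delta^-1 * e x y)); last first.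
  by rewrite ler_wpM2r ?(dist_ge0 em)// lerDr.
apply: (gauge_dominated_le dm em mono) => //;
  [by rewrite eta0|exact: ney|exact: ney|].
rewrite mulrC ler_pdivlMr// mulrC; apply: le_trans dxy.
by rewrite ler_pM2l//; exact: le_diam.
Qed.

Lemma gauge_dominated_decay (R : realType) (X : topologicalType)
    (S : cell_structure X) (eta : R -> R) (d e : X -> X -> R) :
  is_metric d -> is_metric e ->
  (forall s t, 0 <= s -> s <= t -> eta s <= eta t) -> eta 0 = 0 ->
  (forall s, 0 < s -> exists2 t, 0 < t & eta t = s) ->
  gauge_dominated eta d e ->
  exponential_decay S d -> exponential_decay S e.
Proof.
move=> dm em mono eta0 surj dom dd; have cX := compact_cell_structure S.
have eta00 : 0 <= eta 0 by rewrite eta0.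
have dpos n E : cell S n E -> 0 < diam d E.
  exact: exponential_decay_diam_gt0 dm dd.
have epos n E : cell S n E -> 0 < diam e E.
  by move=> /dpos; exact: diam_gt0_transfer.
have [r [rho [C [/andP[r0 r1] rho01 C1 decay]]]] := exponential_decayP dm dd.
have C0 : 0 < C by exact: lt_le_trans C1.
have /andP[rho0 rho1] := rho01.
have rhok k : 0 < rho ^+ k <= 1 by rewrite exprn_gt0//= exprn_ile1// ltW.
have eta_ge0 t : 0 <= t -> 0 <= eta t by move=> t0; rewrite -eta0 mono.
pose K := 2 * (1 + eta (3 * C)).
have K1 : 1 <= K.
  by have := eta_ge0 (3 * C) ltac:(by rewrite mulr_ge0// ltW); rewrite /K; lra.
have K0 : 0 < K by exact: lt_le_trans K1.
have upK m k E F p : cell S m E -> cell S (m + k) F -> E p -> F p ->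
    diam e F <= K * diam e E.
  move=> cE cF Ep Fp; have [_ up] := decay _ _ _ _ _ cE cF Ep Fp.
  apply: (gauge_dominated_diam cX dm em mono eta00 dom Fp Ep (dpos _ _ cE)
    (ltW C0) _).1.
  apply: le_trans up _; rewrite ler_pM2r ?(dpos _ _ cE)// ler_piMr ?(ltW C0)//.
  by case/andP: (rhok k).
clearbody K.
(* The gauge vanishes at 0 but need not be a power, so the exponential rate
   comes from iterating a halving of the diameter every [k0] levels. *)
have [t t0 etat] := surj (4^-1) ltac:(by rewrite invr_gt0).
(* With [M = C * rho ^+ k0], the bound [3 * M < t] makes the factor [2 * eta (3 * M)] at most 1/2,
   and [3 * M < 1/2] gives access to that sharper estimate. *)
have [k1 k1P] : exists k, rho ^+ k < Num.min t (2^-1) / (3 * C).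
  apply: exists_expr_lt => //.
  by rewrite divr_gt0 ?mulr_gt0// lt_min t0 invr_gt0 ltr0n.
(* The successor makes [k0] positive, for the division by [k0] and the [k0]-th root below. *)
pose k0 := k1.+1.
have half m E F p : cell S m E -> cell S (m + k0) F -> E p -> F p ->
    diam e F <= 2^-1 * diam e E.
  move=> cE cF Ep Fp; have [_ up] := decay _ _ _ _ _ cE cF Ep Fp.
  have : 3 * (C * rho ^+ k0) < Num.min t 2^-1.
    move: k1P; rewrite ltr_pdivlMr ?mulr_gt0// => k1P; apply: le_lt_trans k1P.
    rewrite mulrA mulrC ler_pM2r ?mulr_gt0// exprS ler_piMl ?(ltW rho1)//.
    by case/andP: (rhok k1) => /ltW.
  rewrite lt_min => /andP[lt1 lt2].
  have M0 : 0 <= C * rho ^+ k0.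
    by case/andP: (rhok k0) => ? _; rewrite mulr_ge0// ltW.
  have [_] := gauge_dominated_diam cX dm em mono eta00 dom Fp Ep
    (dpos _ _ cE) M0 up.
  move=> /(_ ltac:(lra)) h; apply: le_trans h _.
  rewrite ler_pM2r ?(epos _ _ cE)//.
  have := mono _ _ (mulr_ge0 (ler0n _ 3) M0) (ltW lt1); rewrite etat.
  by lra.
(* Each block of [k0] levels passes through a cell containing [p] and halves the diameter; the
   remaining [k] levels cost the factor [K] once. *)
have halves q : forall m k E F p, cell S m E -> cell S (m + (q * k0 + k)) F ->
    E p -> F p -> diam e F <= K * (2^-1) ^+ q * diam e E.
  elim: q => [|q IH] m k E F p cE cF Ep Fp.
    by rewrite expr0 mulr1; exact: upK cE cF Ep Fp.
  have [G cG Gp] := cell_cover S (m + k0) p.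
  rewrite mulSn -addnA addnA in cF.
  apply: le_trans (IH _ _ _ _ _ cG cF Gp Fp) _.
  rewrite exprSr mulrA -[leRHS]mulrA ler_pM2l; first exact: half cE cG Ep Gp.
  by rewrite mulr_gt0// exprn_gt0// invr_gt0.
pose B := 2 * (1 + eta (3 * (C / r))).
(* The case [j = 0] compares two distinct cells of one level meeting at [p]; it starts the induction
   in [lows] and explains the exponent [k.+1] there. *)
have upM j m E F p : (j <= 1)%N -> cell S m E -> cell S (m + j) F ->
    E p -> F p -> diam e E <= B * diam e F.
  move=> j1 cE cF Ep Fp; have [lo _] := decay _ _ _ _ _ cE cF Ep Fp.
  apply: (gauge_dominated_diam cX dm em mono eta00 dom Ep Fp
    (dpos _ _ cF) _ _).1.
    by rewrite divr_ge0 ?ltW.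
  rewrite mulrAC ler_pdivlMr// mulrC; apply: le_trans lo.
  rewrite ler_pM2r ?(dpos _ _ cE)//.
  by case: j j1 {cF} => [|[|]]// _; rewrite ?expr0 ?expr1 ?ltW.
have B1 : 1 < B.
  have := eta_ge0 (3 * (C / r)) ltac:(by rewrite mulr_ge0// divr_ge0 ?ltW).
  by rewrite /B; lra.
have B0 : 0 < B by exact: lt_trans B1.
clearbody B.
have lows k : forall m E F p, cell S m E -> cell S (m + k) F -> E p -> F p ->
    diam e E <= B ^+ k.+1 * diam e F.
  elim: k => [|k IH] m E F p cE cF Ep Fp.
    by rewrite expr1; exact: upM (leq0n 1) cE cF Ep Fp.
  have [G cG Gp] := cell_cover S (m + 1) p.
  rewrite -addn1 [(k + 1)%N]addnC addnA in cF.
  apply: le_trans (upM _ _ _ _ _ (leqnn 1) cE cG Ep Gp) _.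
  by rewrite exprS -mulrA ler_pM2l//; exact: IH cG cF Gp Fp.
pose s : R := (2^-1) `^ (k0%:R^-1).
have s0 : 0 < s by rewrite powR_gt0// invr_gt0.
have sk : s ^+ k0 = 2^-1.
  by rewrite -powR_mulrn ?(ltW s0)// powRVK ?ltr0n// invr_ge0.
have s1 : s < 1.
  rewrite ltNge; apply/negP => s1.
  by have := exprn_ege1 k0 s1; rewrite sk; lra.
(* The minimum enforces the order of the two rates. [B] absorbs the extra factor in [lows]; the 2 in
   [2 * K] absorbs the fewer than [k0] leftover levels, over which the power of [s] stays at least
   1/2. *)
exists (Num.min B^-1 s), s, (Num.max B (2 * K)); split=> //.
- by rewrite lt_min invr_gt0 B0.
- by rewrite ge_min lexx orbT.
- by rewrite le_max (ltW B1).
move=> m n E F mn cE cF [p [Ep Fp]]; rewrite -(subnKC mn) in cF.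
set k := (n - m)%N in cF *.
have E0 := epos _ _ cE; have F0 := epos _ _ cF.
have mx0 : 0 < Num.max B (2 * K) by rewrite lt_max B0.
apply/andP; split.
  rewrite ler_pdivlMr// mulrAC ler_pdivrMr//.
  apply: (@le_trans _ _ (B^-1 ^+ k * diam e E)).
    rewrite ler_pM2r// lerXn2r ?nnegrE ?ge_min ?lexx// ?invr_ge0 ?(ltW B0)//.
    by rewrite le_min invr_ge0 !ltW.
  apply: (@le_trans _ _ (diam e F * B)); last first.
    by rewrite ler_pM2l// le_max lexx.
  rewrite exprVn mulrC ler_pdivrMr ?exprn_gt0// -mulrA -exprS mulrC.
  exact: lows cE cF Ep Fp.
rewrite ler_pdivrMr//.
have kE : k = (k %/ k0 * k0 + k %% k0)%N by exact: divn_eq.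
rewrite {1}kE in cF; apply: le_trans (halves _ _ _ _ _ _ cE cF Ep Fp) _.
rewrite ler_pM2r//; apply: (@le_trans _ _ (2 * K * s ^+ k)); last first.
  by rewrite ler_pM2r ?exprn_gt0// le_max lexx orbT.
rewrite [2 * K]mulrC -mulrA ler_pM2l// {2}kE exprD mulnC exprM sk mulrCA.
rewrite ler_peMr ?exprn_ge0 ?invr_ge0//.
have : 2^-1 <= s ^+ (k %% k0).
  rewrite -sk; apply: ler_wiXn2l; rewrite ?(ltW s0) ?(ltW s1)//.
  by rewrite ltnW// ltn_mod.
by lra.
Qed.

Theorem corollary12 (R : realType) (X Y : metricType R)
    (S : cell_structure X) (f : X -> Y)
    (undistorted_X : undistorted S (@mdist R X))
    (homeo_f : homeomorphism f) :
  quasisymmetry f <-> undistorted S (pullback_metric f (@mdist R Y)).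
Proof.
split=> [[_ [eta homeo_eta dom]]|undistorted_Y].
  (* By unfolding, [dom] is [gauge_dominated eta] from [mdist] to the pullback. *)
  have [dm dd sep] := undistorted_X; have em := is_metric_pullback homeo_f.
  have [eta0 mono surj] := homeomorphism_nneg_le homeo_eta.
  split=> //; first exact: gauge_dominated_decay mono eta0 surj dom dd.
  exact: gauge_dominated_separation mono eta0 dom sep.
have [K [L [al [be [K0 L0 al0 be0 qs]]]]] :=
  undistorted_power_quasisymmetric undistorted_X undistorted_Y.
split=> //; exists (fun t => K * Num.max ((L * t) `^ al) ((L * t) `^ be)).
  exact: homeomorphism_max_powR.
by move=> a b c ab ac _; exact: qs.
Qed.
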